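(* Starting with an empty graph on $n$ vertices, under any sequence of edge insertions that keeps the graph bipartite, an explicit $(1+2\log n)$-coloring can be maintained deterministically with at most one recoloring per update in the worst case, amortized $O(\alpha(n))$ update time, and worst-case $O(1)$ query time, where $\alpha(n)$ is the inverse Ackermann function.
   Context: An explicit $c$-coloring algorithm stores, after each update, a color from $\{1,\dots,c\}$ for every vertex such that adjacent vertices receive different colors; a query returns the color of a given vertex. A recoloring is a change of the color of one vertex during an update. Logarithms are base 2. *)

(* Defs.v *)
From Stdlib Require Import Reals.
From mathcomp Require Import all_boot.

Set Implicit Arguments.
Unset Strict Implicit.
Unset Printing Implicit Defensive.

Section Graphs.
Variable T : eqType.

Definition adj (E : seq (T * T)) : rel T :=
  fun u v => ((u, v) \in E) || ((v, u) \in E).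

Definition bipartite (e : rel T) : Prop :=
  exists side : T -> bool, forall u v, e u v -> side u <> side v.

Definition proper_coloring (e : rel T) (col : T -> nat) : Prop :=
  forall u v, e u v -> col u <> col v.

End Graphs.

(** Ackermann-Peter function: [ack 0 n = n + 1], [ack (m + 1) 0 = ack m 1],
    [ack (m + 1) (n + 1) = ack m (ack (m + 1) n)]. *)
Fixpoint ack (m : nat) : nat -> nat :=
  match m with
  | 0 => S
  | m'.+1 => fix ackm (n : nat) : nat :=
      match n with
      | 0 => ack m' 1
      | n'.+1 => ack m' (ackm n')
      end
  end.

Lemma ack_gt m n : n < ack m n.
Proof.
elim: m n => [|m IHm] n //=.
elim: n => [|n IHn]; first exact: ltn_trans (IHm 1).
exact: leq_ltn_trans IHn (IHm _).
Qed.

Lemma ack_diag_unbounded n : exists k, n <= ack k k.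
Proof. by exists n; apply/ltnW/ack_gt. Qed.

(** The least [k] with [ack k k >= n]; it is at least 1 as soon as [n >= 2]. *)
Definition inv_ack (n : nat) : nat := ex_minn (ack_diag_unbounded n).

Definition log2 (x : R) : R := Rdiv (ln x) (ln 2).

(** Membership in the palette [{1, ..., c}], for a real number [c] of colors. *)
Definition in_palette (c : R) (k : nat) : Prop := 1 <= k /\ Rle (INR k) c.

(** Word RAM programs are structured, with three-address instructions on registers and a
    word-addressed memory.  Every instruction and every evaluation of a guard
    takes one time unit.  [exec W c s t s'] says that [c], started in [s], halts
    in [s'] after [t] time units.  Words range over [0 .. W - 1]: an instruction
    whose result or address is not a word has no transition. *)

Inductive operand := Imm of nat | Reg of nat.

Inductive binop := Add | Sub | Mul | Div | Mod.

Inductive test := Eq | Lt.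

Inductive cmd :=
  | Skip
  | Move of nat & operand
  | Arith of nat & binop & operand & operand
  | Read of nat & operand
  | Write of operand & operand
  | Seq of cmd & cmd
  | If of test & operand & operand & cmd & cmd
  | While of test & operand & operand & cmd.

Record state := State { reg : nat -> nat; mem : nat -> nat }.

Definition upd (f : nat -> nat) (i x : nat) : nat -> nat :=
  fun j => if j == i then x else f j.

Definition set_reg (s : state) (i x : nat) := State (upd (reg s) i x) (mem s).
Definition set_mem (s : state) (i x : nat) := State (reg s) (upd (mem s) i x).

Definition val_of (s : state) (a : operand) : nat :=
  match a with Imm k => k | Reg i => reg s i end.

Definition binop_val (o : binop) : nat -> nat -> nat :=
  match o with
  | Add => addn | Sub => subn | Mul => muln | Div => divn | Mod => modn
  end.

Definition test_val (b : test) : nat -> nat -> bool :=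
  match b with Eq => eqn | Lt => ltn end.

Inductive exec (W : nat) : cmd -> state -> nat -> state -> Prop :=
  | exec_skip s : exec W Skip s 1 s
  | exec_move s i a : val_of s a < W ->
      exec W (Move i a) s 1 (set_reg s i (val_of s a))
  | exec_arith s i o a b : binop_val o (val_of s a) (val_of s b) < W ->
      exec W (Arith i o a b) s 1
        (set_reg s i (binop_val o (val_of s a) (val_of s b)))
  | exec_read s i a : val_of s a < W ->
      exec W (Read i a) s 1 (set_reg s i (mem s (val_of s a)))
  | exec_write s a b : val_of s a < W -> val_of s b < W ->
      exec W (Write a b) s 1 (set_mem s (val_of s a) (val_of s b))
  | exec_seq s c1 t1 s1 c2 t2 s2 :
      exec W c1 s t1 s1 -> exec W c2 s1 t2 s2 ->
      exec W (Seq c1 c2) s (t1 + t2) s2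
  | exec_if_true s b x y c1 c2 t s' : test_val b (val_of s x) (val_of s y) ->
      exec W c1 s t s' -> exec W (If b x y c1 c2) s t.+1 s'
  | exec_if_false s b x y c1 c2 t s' : ~~ test_val b (val_of s x) (val_of s y) ->
      exec W c2 s t s' -> exec W (If b x y c1 c2) s t.+1 s'
  | exec_while_true s b x y c t1 s1 t2 s2 :
      test_val b (val_of s x) (val_of s y) ->
      exec W c s t1 s1 -> exec W (While b x y c) s1 t2 s2 ->
      exec W (While b x y c) s (t1 + t2).+1 s2
  | exec_while_false s b x y c : ~~ test_val b (val_of s x) (val_of s y) ->
      exec W (While b x y c) s 1 s.

Lemma exec_det W c s t s' t' s'' :
  exec W c s t s' -> exec W c s t' s'' -> t = t' /\ s' = s''.
Proof.
move=> H; elim: H t' s'' => {c s t s'}.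
- by move=> s t' s'' H; inversion H.
- by move=> s i a _ t' s'' H; inversion H.
- by move=> s i o a b _ t' s'' H; inversion H.
- by move=> s i a _ t' s'' H; inversion H.
- by move=> s a b _ _ t' s'' H; inversion H.
- move=> s c1 t1 s1 c2 t2 s2 _ IH1 _ IH2 t' s'' H; inversion H; subst.
  match goal with E : exec W c1 _ _ _ |- _ => case: (IH1 _ _ E) => ? ?; subst end.
  by match goal with E : exec W c2 _ _ _ |- _ => case: (IH2 _ _ E) => ? ?; subst end.
- move=> s b x y c1 c2 t s' Hb _ IH t' s'' H; inversion H; subst; last first.
    by match goal with E : is_true (~~ _) |- _ => rewrite Hb in E end.
  by match goal with E : exec W c1 _ _ _ |- _ => case: (IH _ _ E) => ? ?; subst end.
- move=> s b x y c1 c2 t s' Hb _ IH t' s'' H; inversion H; subst.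
    by move: Hb; match goal with E : is_true (test_val _ _ _) |- _ => rewrite E end.
  by match goal with E : exec W c2 _ _ _ |- _ => case: (IH _ _ E) => ? ?; subst end.
- move=> s b x y c t1 s1 t2 s2 Hb _ IH1 _ IH2 t' s'' H; inversion H; subst;
    last by match goal with E : is_true (~~ _) |- _ => rewrite Hb in E end.
  match goal with E : exec W c _ _ _ |- _ => case: (IH1 _ _ E) => ? ?; subst end.
  by match goal with E : exec W (While _ _ _ _) _ _ _ |- _ =>
       case: (IH2 _ _ E) => ? ?; subst end.
- move=> s b x y c Hb t' s'' H; inversion H; subst => //.
  by move: Hb; match goal with E : is_true (test_val _ _ _) |- _ => rewrite E end.
Qed.

(** Words have [K * (floor (log2 n) + 1)] bits, i.e. [O(log n)] for a constant
    [K]. *)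
Definition word_bound (K n : nat) : nat := 2 ^ (K * (trunc_log 2 n).+1).

(** One uniform triple of programs for all [n].  [init] finds [n] in register 0,
    [insert] finds the endpoints of the new edge in registers 0 and 1, and
    [query] finds the vertex in register 0 and leaves the answer there.  All
    registers and the memory persist between calls. *)
Record algorithm := Algorithm { init : cmd; insert : cmd; query : cmd }.

Definition start (n : nat) : state := set_reg (State (fun=> 0) (fun=> 0)) 0 n.
Definition insert_call (s : state) (u v : nat) := set_reg (set_reg s 0 u) 1 v.
Definition query_call (s : state) (v : nat) := set_reg s 0 v.

(** The color of vertex [v] is stored in memory cell [v]. *)
Definition color n (s : state) (v : 'I_n) : nat := mem s v.

Inductive op (n : nat) := Insert of 'I_n & 'I_n | Query of 'I_n.
Arguments Insert {n}.
Arguments Query {n}.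

Definition edges n (ops : seq (op n)) : seq ('I_n * 'I_n) :=
  pmap (fun o => if o is Insert u v then Some (u, v) else None) ops.

(** [run A W ops s T]: [A], initialized and then given the operations [ops] in
    this order, is in state [s], and the updates among [ops] have taken [T] time
    units altogether. *)
Inductive run (A : algorithm) (W n : nat) : seq (op n) -> state -> nat -> Prop :=
  | run_init t s : exec W (init A) (start n) t s -> run A W (Nil (op n)) s 0
  | run_insert (ops : seq (op n)) s T (u v : 'I_n) t s' : run A W ops s T ->
      exec W (insert A) (insert_call s u v) t s' ->
      run A W (rcons ops (Insert u v)) s' (T + t)
  | run_query (ops : seq (op n)) s T (v : 'I_n) t s' : run A W ops s T ->
      exec W (query A) (query_call s v) t s' ->
      run A W (rcons ops (Query v)) s' T.

Definition recolorings n (s s' : state) : nat :=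
  #|[set x : 'I_n | color s x != color s' x]|.

(* Main.v *)
(** Union-find with union by rank and path compression, where each link also
    records whether its two ends lie on the same side of the bipartition.  Level
    [0] has the single color [1], level [r >= 1] the colors [2 r] and [2 r + 1].
    A tree of rank [r] uses only levels [<= r], and its level [r] colors are
    assigned according to the side.  When a new edge joins two vertices of equal
    color, moving one of them to the top level of the (merged) tree is therefore
    enough: a merge either raises the rank, so that the top level is fresh, or
    attaches a tree that does not use it.  Ranks are at most [log2 n].

    The inverse Ackermann bound uses a potential: a node of rank [r] whose parent
    has rank [q] carries the number of pairs [(k, i)] with [k < L], [i < r + 2] and
    [q < ack_k^(i+1) (r)]; a root of rank [r] carries [L r], where
    [L = inv_ack n + 2].  It is initially zero, so that the time is bounded in
    terms of the number of insertions alone. *)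
Require Import Defs.
From Stdlib Require Import Reals Lra.
From mathcomp Require Import all_boot zify.

Set Implicit Arguments.
Unset Strict Implicit.
Unset Printing Implicit Defensive.

(** * Ackermann potential *)

Lemma ltn_ackS m n : ack m n < ack m n.+1.
Proof. by case: m => [|m] //=; apply: ack_gt. Qed.

Lemma leq_ack m : {homo ack m : x y / x <= y}.
Proof. by apply: homo_leq leq_trans _ => // n; apply/ltnW/ltn_ackS. Qed.

Lemma ackS_iter m n : ack m.+1 n = iter n.+1 (ack m) 1.
Proof. by elim: n => //= n ->. Qed.

Lemma leq_iter_ack m i : {homo iter i (ack m) : x y / x <= y}.
Proof. by elim: i => //= i IH x y /IH; apply: leq_ack. Qed.

Lemma leq_ackl n : {homo ack^~ n : k m / k <= m}.
Proof.
apply: homo_leq leq_trans _ => // m; rewrite ackS_iter iterSr.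
case: n => [|n]; first exact: leq_ack.
rewrite iterS; apply: leq_ack.
elim: n => [|n IH]; first exact: ltn_trans (ack_gt m 1).
by rewrite iterS; apply: leq_ltn_trans IH (ack_gt _ _).
Qed.

Lemma ltn_ack0 m : m < ack m 0.
Proof. by elim: m => //= m IH; apply: leq_ltn_trans IH (ltn_ackS m 0). Qed.

(** With [a = inv_ack n], [ack a.+2 0] unfolds to [ack a] at an argument of at least [a]. Hence the
    two extra levels in [L]: all ranks are below [n], so below [ack L 0]. *)
Lemma leq_ack_inv_ack n : n <= ack (inv_ack n).+2 0.
Proof.
rewrite /inv_ack; case: ex_minnP => a /leq_trans le_n _; apply: le_n => /=.
apply: leq_ack; apply: ltnW; apply: leq_trans (ltn_ack0 a) _; exact: leq_ack.
Qed.

Lemma inv_ack_gt0 n : 1 < n -> 0 < inv_ack n.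
Proof. by rewrite /inv_ack; case: ex_minnP => [[|a] //= le_n _]; case: n le_n => [|[]]. Qed.

Lemma leq_b2n (b c : bool) : (b -> c) -> b <= c.
Proof. by case: b c => [] [] // /(_ isT). Qed.

Lemma ltn_sum_strict (I : finType) (F G : I -> nat) (i : I) :
  (forall j, F j <= G j) -> F i < G i -> \sum_j F j < \sum_j G j.
Proof.
move=> le_FG lt_i; rewrite (bigD1 i) //= [X in _ < X](bigD1 i) //= -addSn.
by apply: leq_add => //; apply: leq_sum.
Qed.

Definition node_potential L r q : nat :=
  \sum_(k < L) \sum_(i < r.+2) (q < iter i.+1 (ack k) r).

(** A credit for find paths, [R] being the rank of the root: it drops at every edge whose
    compression does not lower the potential, and it never exceeds [L]. *)
Definition reached_levels L R r : nat := \sum_(k < L) (ack k r <= R).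

Lemma node_potential_ub L r q : node_potential L r q <= L * r.+2.
Proof.
rewrite /node_potential -[L in L * _]card_ord -sum_nat_const.
apply: leq_sum => k _; rewrite -[r.+2 in X in _ <= X]card_ord -sum1_card.
by apply: leq_sum => i _; apply: leq_b1.
Qed.

Lemma node_potential_anti L r q q' : q <= q' ->
  node_potential L r q' <= node_potential L r q.
Proof.
move=> le_q; apply: leq_sum => k _; apply: leq_sum => i _.
by apply: leq_b2n; apply: leq_ltn_trans.
Qed.

Lemma reached_levels_ub L R r : reached_levels L R r <= L.
Proof.
rewrite -[X in _ <= X]card_ord -sum1_card.
by apply: leq_sum => k _; apply: leq_b1.
Qed.

(* Let [k] be the level of the edge from rank [r] to rank [q].  Either level [k]
   is still reached from [q], and then the [k]-part of the potential drops, or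
   the edge is the last one on the path from which [k] is reached. *)
Lemma node_potential_compress L r q R : r < q -> q <= R -> R < ack L 0 ->
  (node_potential L r R + reached_levels L R q).+1
    <= node_potential L r q + reached_levels L R r.
Proof.
move=> lt_rq le_qR lt_RL.
(* The largest [k] with [ack k r <= q]; it is below [L] because [q <= R < ack L 0]. *)
have [k [lt_kL le_k lt_k]] : exists k, [/\ k < L, ack k r <= q & q < ack k.+1 r].
  have exk : exists k, ack k r <= q by exists 0.
  have ubk k : ack k r <= q -> k <= q.
    move=> le; apply: leq_trans le; apply: ltnW.
    by apply: leq_trans (ltn_ack0 k) _; apply: leq_ack.
  case: (ex_maxnP exk ubk) => k le_k max_k; exists k; split=> //.
    rewrite ltnNge; apply/negP => le_Lk.
    have: ack L r <= q by apply: leq_trans le_k; apply: leq_ackl.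
    move/leq_trans/(_ le_qR) => le; have := @leq_ack L 0 r (leq0n r).
    by rewrite leqNgt (leq_ltn_trans le lt_RL).
  by rewrite ltnNge; apply/negP => /max_k; rewrite ltnn.
have le_levels : reached_levels L R q <= reached_levels L R r.
  by apply: leq_sum => j _; apply: leq_b2n; apply/leq_trans/leq_ack/ltnW.
have [le_kR|lt_Rk] := leqP (ack k q) R; last first.
  rewrite -addnS leq_add ?node_potential_anti //.
  apply: (@ltn_sum_strict _ _ _ (Ordinal lt_kL)) => /= [j|].
    by apply: leq_b2n; apply/leq_trans/leq_ack/ltnW.
  by rewrite (leq_trans le_k) // (leqNgt (ack k q)) lt_Rk.
rewrite -addSn leq_add //.
(* [ack k.+1 r] is the [r.+1]-fold iterate of [ack k] at 1, hence at most the [r.+2]-fold one at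
   [r]; this is why [i] ranges below [r.+2]. *)
have top : q < iter r.+2 (ack k) r.
  apply: leq_trans lt_k _; rewrite ackS_iter [X in _ <= X]iterSr.
  by apply: leq_iter_ack; apply: leq_ltn_trans (ack_gt k r).
have exi : exists i, q < iter i.+1 (ack k) r by exists r.+1.
(* By minimality [iter i (ack k) r <= q], so [iter i.+1 (ack k) r <= ack k q <= R]: the pair
   [(k, i)] counts for [q] but not for [R]. *)
case: (ex_minnP exi) => i lt_i min_i.
have le_i : i < r.+2 by apply: (min_i r.+1).
have prev : iter i (ack k) r <= q.
  case: i {lt_i le_i} min_i => [_|i min_i] /=; first exact: ltnW.
  by rewrite leqNgt; apply/negP => /min_i; rewrite ltnn.
apply: (@ltn_sum_strict _ _ _ (Ordinal lt_kL)) => [j|].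
  by apply: leq_sum => i' _; case: ltnP => // /(leq_ltn_trans le_qR) ->.
apply: (@ltn_sum_strict _ _ _ (Ordinal le_i)) => [i'|].
  by apply: leq_b2n; apply: leq_ltn_trans.
rewrite lt_i (ltnNge R) /= (leq_trans _ le_kR) //; exact: leq_ack.
Qed.

(** * Union-find forests *)

(* Memory layout: the color of [x] is in cell [x], the link of [x] in cell
   [n + x], its rank in cell [2 n + x].  A root has link 0; a link to the parent
   [y] is [2 (y + 1) + b], where [b] tells whether [x] and [y] lie on different
   sides of the bipartition. *)
Definition link n (m : nat -> nat) x := m (n + x).
Definition rank n (m : nat -> nat) x := m (n + n + x).
Definition parent n m x := if link n m x == 0 then x else (link n m x %/ 2).-1.

(* [rep] and [sd] are ghost functions: the root of the tree of [x], and the side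
   of [x] relative to that root. *)
Record forest n (m : nat -> nat) (rep : nat -> nat) (sd : nat -> bool) : Prop :=
  Forest {
    parent_lt : forall x, x < n -> parent n m x < n;
    rep_lt : forall x, x < n -> rep x < n;
    rep_root : forall x, x < n -> link n m x = 0 -> rep x = x;
    link_rep : forall x, x < n -> link n m (rep x) = 0;
    rep_parent : forall x, x < n -> rep (parent n m x) = rep x;
    side_parent : forall x, x < n ->
      sd x = sd (parent n m x) (+) odd (link n m x);
    side_rep : forall x, x < n -> sd (rep x) = false;
    rank_parent : forall x, x < n -> link n m x != 0 ->
      rank n m x < rank n m (parent n m x);
    rank_rep : forall x, x < n -> rank n m x <= rank n m (rep x);
    rank_size : forall x, x < n ->
      2 ^ rank n m (rep x) <= \sum_(y < n) (rep y == rep x) }.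

Definition potential L n m : nat :=
  \sum_(x < n) (if link n m x == 0 then L * rank n m x
                else node_potential L (rank n m x) (rank n m (parent n m x))).

Fixpoint depth n m d x : Prop :=
  if d is d'.+1 then link n m x <> 0 /\ depth n m d' (parent n m x)
  else link n m x = 0.

Lemma rep_rep n m rep sd : forest n m rep sd ->
  forall x, x < n -> rep (rep x) = rep x.
Proof. by move=> F x xn; apply: rep_root F _ (rep_lt F xn) (link_rep F xn). Qed.

Lemma rank_ub n m rep sd : forest n m rep sd ->
  forall x, x < n -> 2 ^ rank n m (rep x) <= n.
Proof.
move=> F x xn; apply: leq_trans (rank_size F xn) _.
rewrite -[X in _ <= X]card_ord -sum1_card; apply: leq_sum => y _; exact: leq_b1.
Qed.

Lemma rank_lt n m rep sd : forest n m rep sd ->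
  forall x, x < n -> rank n m x < n.
Proof.
move=> F x xn; apply: leq_ltn_trans (rank_rep F xn) _.
by apply: leq_trans (rank_ub F xn); apply: ltn_expl.
Qed.

Lemma link_ub n m rep sd : forest n m rep sd ->
  forall x, x < n -> link n m x <= 2 * n + 1.
Proof. by move=> F x /(parent_lt F); rewrite /parent; case: eqP; lia. Qed.

Lemma parent_linked n m x : link n m x <> 0 -> parent n m x = (link n m x %/ 2).-1.
Proof. by rewrite /parent => /eqP/negPf ->. Qed.

(** Ranks strictly increase along links and stay below [n]. *)
Lemma depth_exists n m rep sd : forest n m rep sd ->
  forall x, x < n -> exists d, depth n m d x.
Proof.
move=> F x; move: {2}(n - rank n m x) (leqnn (n - rank n m x)) => k.
elim: k x => [|k IH] x lek xn; first by have := rank_lt F xn; lia.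
have [lx|lx] := eqVneq (link n m x) 0; first by exists 0.
have px := parent_lt F xn.
have [] := IH (parent n m x) _ px; first by have := rank_parent F xn lx; lia.
by move=> d hd; exists d.+1; split=> //; apply/eqP.
Qed.

Lemma updE f i (x : nat) j : upd f i x j = if j == i then x else f j.
Proof. by []. Qed.

(** * Path compression at a single node *)

Section Relink.
Variables (n : nat) (m : nat -> nat) (rep : nat -> nat) (sd : nat -> bool).
Hypothesis F : forest n m rep sd.
Variable x : nat.
Hypotheses (xn : x < n) (lx : link n m x <> 0).

Let m' := upd m (n + x) (2 * (rep x).+1 + sd x).

Lemma link_relink y : link n m' y = if y == x then 2 * (rep x).+1 + sd x else link n m y.
Proof. by rewrite /link /m' updE eqn_add2l. Qed.

Lemma rank_relink y : rank n m' y = rank n m y.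
Proof. by rewrite /rank /m' updE; case: eqP => //; lia. Qed.

Lemma parent_relink y : parent n m' y = if y == x then rep x else parent n m y.
Proof.
rewrite /parent link_relink; case: (y == x) => //.
by case: (sd x) => /=; lia.
Qed.

Lemma rank_relinked : rank n m x < rank n m (rep x).
Proof.
have := rank_parent F xn (introN eqP lx).
by move/leq_trans; apply; rewrite -(rep_parent F xn); apply: rank_rep F _ (parent_lt F xn).
Qed.

(** The ghost functions survive: roots have side [false], so [sd x] is the right bit for a direct
    link to [rep x]. *)
Lemma relink_forest : forest n m' rep sd.
Proof.
have nrx : rep x == x = false.
  by apply/eqP => e; apply: lx; rewrite -e (link_rep F xn).
split=> y yn; rewrite ?link_relink ?parent_relink ?rank_relink.
- by case: eqP => _; [apply: rep_lt F _ xn | apply: parent_lt F _ yn].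
- exact: rep_lt F _ yn.
- by case: eqP => [_|_]; [lia | apply: rep_root F _ yn].
- case: eqP => [e|_]; last exact: link_rep F _ yn.
  by case: lx; rewrite -e (link_rep F yn).
- case: eqP => [->|_]; last exact: rep_parent F _ yn.
  by rewrite (rep_rep F xn).
- case: eqP => [->|_]; last exact: side_parent F _ yn.
  by rewrite (side_rep F xn) oddD oddM /= oddb.
- exact: side_rep F _ yn.
- case: (y =P x) => [-> _|_]; first exact: rank_relinked.
  exact: rank_parent F _ yn.
- exact: rank_rep F _ yn.
- exact: rank_size F _ yn.
Qed.

(** Ranks increase along the path from [y], which therefore avoids the redirected node. *)
Lemma relink_depth d y : y < n -> rank n m x < rank n m y ->
  depth n m d y -> depth n m' d y.
Proof.
elim: d y => [|d IH] y yn lt_r /=; rewrite link_relink ?parent_relink.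
  by case: eqP => // e; move: lt_r; rewrite e ltnn.
case: eqP => [e|_]; first by move: lt_r; rewrite e ltnn.
move=> [ly dy]; split=> //; apply: IH => //; first exact: parent_lt F _ yn.
by apply: ltn_trans lt_r (rank_parent F yn _); apply/eqP.
Qed.

(** The unit on the left pays for visiting [x]; the [reached_levels] terms telescope along the
    path. *)
Lemma relink_potential L : n <= ack L 0 ->
  let lev := reached_levels L (rank n m (rep x)) in
  (potential L n m' + lev (rank n m (parent n m x))).+1
    <= potential L n m + lev (rank n m x).
Proof.
move=> nL /=; rewrite /potential (bigD1 (Ordinal xn)) //=.
rewrite [X in _ <= X + _](bigD1 (Ordinal xn)) //=.
rewrite (eq_bigr (fun y : 'I_n => if link n m y == 0 then L * rank n m y
   else node_potential L (rank n m y) (rank n m (parent n m y)))); last first.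
  move=> y ne; have ne' : (y : nat) == x = false by move: ne; rewrite -val_eqE => /negPf.
  by rewrite link_relink parent_relink !rank_relink ne'.
rewrite link_relink parent_relink !rank_relink eqxx /=.
move/eqP/negPf: (lx) => ->.
have := rank_parent F xn (introN eqP lx).
have le : rank n m (parent n m x) <= rank n m (rep x).
  by rewrite -(rep_parent F xn); apply: rank_rep F _ (parent_lt F xn).
have lt : rank n m (rep x) < ack L 0.
  exact: leq_trans (rank_lt F (rep_lt F xn)) nL.
by move=> /node_potential_compress /(_ le lt); lia.
Qed.

End Relink.

(** * Linking one root below another *)

Section Unite.
Variables (n : nat) (m m' : nat -> nat) (rep : nat -> nat) (sd : nat -> bool).
Hypothesis F : forest n m rep sd.
Variables (a b : nat) (w : bool).
Hypotheses (an : a < n) (bn : b < n) (la : link n m a = 0) (lb : link n m b = 0).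
Hypotheses (ab : a <> b) (rab : rank n m b <= rank n m a).
Hypothesis linkE : forall x, x < n ->
  link n m' x = if x == b then 2 * a.+1 + w else link n m x.
Hypothesis rankE : forall x, x < n ->
  rank n m' x = rank n m x + ((x == a) && (rank n m a == rank n m b)).

Definition unite_rep x := if rep x == b then a else rep x.
Definition unite_side x := sd x (+) ((rep x == b) && w).

Lemma parent_unite x : x < n -> parent n m' x = if x == b then a else parent n m x.
Proof.
move=> xn; rewrite /parent linkE //; case: (x == b) => //.
by case: w linkE => /= _; lia.
Qed.

Lemma unite_forest : forest n m' unite_rep unite_side.
Proof.
have repa : rep a = a := rep_root F an la.
have repb : rep b = b := rep_root F bn lb.
have anb : a == b = false by apply/eqP.
have sda : sd a = false by rewrite -repa (side_rep F an).
have sdb : sd b = false by rewrite -repb (side_rep F bn).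
have unlt x : x < n -> unite_rep x < n.
  by rewrite /unite_rep; case: eqP => // _ /(rep_lt F).
split=> x xn.
- by rewrite parent_unite //; case: ifP => // _; apply: parent_lt F _ xn.
- exact: unlt.
- rewrite linkE //; case: eqP => [|ne l0]; first by lia.
  by rewrite /unite_rep (rep_root F xn l0); move/eqP/negPf: ne => ->.
- rewrite linkE ?unlt //; rewrite /unite_rep; case: (rep x =P b) => [_|ne].
    by rewrite anb.
  by move/eqP/negPf: ne => ->; apply: link_rep F _ xn.
- rewrite parent_unite // /unite_rep; case: (x =P b) => [->|_].
    by rewrite repa repb eqxx anb.
  by rewrite (rep_parent F xn).
- rewrite parent_unite // linkE // /unite_side; case: (x =P b) => [->|_].
    by rewrite repa repb eqxx anb sda sdb oddD oddM /= oddb.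
  by rewrite (rep_parent F xn) (side_parent F xn) -!addbA; congr (_ (+) _); rewrite addbC.
- rewrite /unite_side /unite_rep; case: (rep x =P b) => [_|ne].
    by rewrite repa anb sda.
  by rewrite (rep_rep F xn) (side_rep F xn); move/eqP/negPf: ne => ->.
- rewrite linkE // parent_unite //; case: (x =P b) => [-> _|_ lx].
    rewrite !rankE // eqxx [b == a]eq_sym anb /=.
    by case: eqP; lia.
  have := rank_parent F xn lx; have pn := parent_lt F xn; rewrite !rankE //.
  have -> : x == a = false by apply/eqP => e; rewrite e la in lx.
  by rewrite /=; lia.
- have rb := rank_rep F xn; rewrite !rankE ?unlt // /unite_rep.
  case: (rep x =P b) => [e|_].
    rewrite e in rb; have -> : x == a = false by apply/eqP => ea; rewrite ea repa in e.
    by rewrite eqxx; case: eqP; lia.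
  case: (x =P a) => [->|_]; first by rewrite repa eqxx.
  by case: eqP; lia.
- rewrite rankE ?unlt // {1 2}/unite_rep.
  have count c : (forall y, (rep y == c) -> unite_rep y = unite_rep x) ->
    \sum_(y < n) (rep y == c) <= \sum_(y < n) (unite_rep y == unite_rep x).
    by move=> h; apply: leq_sum => y _; apply: leq_b2n => /h ->; rewrite eqxx.
  (* If the ranks are equal, the rank grows by one, and the sizes of the two trees add up to the
     doubled bound. *)
  have toa : unite_rep x = a -> 2 ^ (rank n m a + (true && (rank n m a == rank n m b)))
      <= \sum_(y < n) (unite_rep y == unite_rep x).
    move=> ea /=; case: eqP => [e|_].
      rewrite addn1 expnS mul2n -addnn {2}e.
      have := rank_size F an; have := rank_size F bn; rewrite repa repb => hb ha.
      apply: leq_trans (leq_add ha hb) _; rewrite -big_split /=.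
      apply: leq_sum => y _; rewrite ea /unite_rep.
      case: (rep y =P b) => [->|_]; last by rewrite addn0.
      by rewrite [b == a]eq_sym anb eqxx.
    rewrite addn0; have := rank_size F an; rewrite repa => /leq_trans; apply.
    by apply: count => y /eqP; rewrite ea /unite_rep => ->; rewrite anb.
  case: (rep x =P b) => [e|ne].
    by rewrite eqxx; apply: toa; rewrite /unite_rep e eqxx.
  case: (rep x =P a) => [e|ne'].
    by rewrite e; apply: toa; rewrite /unite_rep e anb.
  rewrite addn0; apply: leq_trans (rank_size F xn) (count _ _) => y /eqP e.
  by rewrite /unite_rep e.
Qed.

(** The rank of [a] grows by at most one, costing [L]; [b] trades [L * r] for at most [L * r.+2],
    costing [2 * L]. No other node gains, since the ranks of parents do not fall. *)
Lemma unite_potential L : potential L n m' <= potential L n m + 3 * L.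
Proof.
have anb : a == b = false by apply/eqP.
have -> : 3 * L = \sum_(x < n) ((x == Ordinal an) * L + (x == Ordinal bn) * (2 * L)).
  rewrite big_split /= (bigD1 (Ordinal an)) //= eqxx big1 => [|x /negPf -> //].
  by rewrite (bigD1 (Ordinal bn)) //= eqxx big1 => [|x /negPf -> //]; lia.
rewrite /potential -big_split /=; apply: leq_sum => x _.
rewrite -!val_eqE /= linkE // parent_unite //; have xn := ltn_ord x.
case: (val x =P b) => [e|_] /=.
  rewrite /= in e; rewrite e lb [b == a]eq_sym anb eqxx !rankE // [b == a]eq_sym anb /=.
  rewrite ?addn0.
  by apply: leq_trans (node_potential_ub _ _ _) _; lia.
case: ifP => lx.
  rewrite rankE // mul0n addn0 mulnDr leq_add2l mulnC leq_mul2r.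
  by apply/orP; right; apply: leq_b2n => /andP[].
have -> : (x : nat) == a = false by apply/eqP => e; rewrite e la in lx.
rewrite !addn0 !rankE ?(parent_lt F) //.
have -> : (x : nat) == a = false by apply/eqP => e; rewrite e la in lx.
by rewrite addn0 node_potential_anti // leq_addr.
Qed.

End Unite.

(** * Colorings *)

(* Colors [2 r] and [2 r + 1] form level [r].  In a tree of rank [r], level [r]
   is the highest level used, and its two colors tell the sides apart; nothing is
   required of the lower levels. *)
Record consistent n (m rep : nat -> nat) (sd : nat -> bool)
    (E : seq ('I_n * 'I_n)) : Prop := Consistent {
  edge_rep : forall u v : 'I_n, (u, v) \in E -> rep u = rep v;
  edge_side : forall u v : 'I_n, (u, v) \in E -> sd u <> sd v;
  color_gt0 : forall x, x < n -> 0 < m x;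
  color_level : forall x, x < n -> m x %/ 2 <= rank n m (rep x);
  color_top : forall x, x < n -> 0 < rank n m (rep x) ->
    m x %/ 2 = rank n m (rep x) -> odd (m x) = sd x;
  side_forced : forall side : nat -> bool,
    (forall u v : 'I_n, (u, v) \in E -> side u <> side v) ->
    forall x, x < n -> side x = side (rep x) (+) sd x }.

Definition properly_colored n (m : nat -> nat) (E : seq ('I_n * 'I_n)) : Prop :=
  forall u v : 'I_n, (u, v) \in E -> m u <> m v.

Lemma bipartite_side n (E : seq ('I_n * 'I_n)) : bipartite (adj E) ->
  exists side : nat -> bool, forall u v : 'I_n, (u, v) \in E -> side u <> side v.
Proof.
move=> [side sideP]; exists (fun x => if insub x is Some i then side i else false).
by move=> u v uv; rewrite !valK; apply: sideP; rewrite /adj uv.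
Qed.

Lemma bipartite_rcons n (E : seq ('I_n * 'I_n)) e :
  bipartite (adj (rcons E e)) -> bipartite (adj E).
Proof.
move=> [side sideP]; exists side => u v; rewrite /adj => uv; apply: sideP.
by rewrite /adj !mem_rcons !inE; case/orP: uv => ->; rewrite !orbT.
Qed.

Section Coloring.
Variables (n : nat) (m m' : nat -> nat) (rep : nat -> nat) (sd : nat -> bool).
Variables (E : seq ('I_n * 'I_n)) (u v : 'I_n).
Hypotheses (F : forest n m rep sd) (C : consistent m rep sd E).

(** By [side_forced], every bipartition of the extended graph agrees with [sd] on the common tree up
    to a flip, so the new edge joins opposite sides. *)
Lemma consistent_rcons : rep u = rep v -> bipartite (adj (rcons E (u, v))) ->
  consistent m rep sd (rcons E (u, v)).
Proof.
move=> ruv bip; have sub e : e \in E -> e \in rcons E (u, v).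
  by rewrite mem_rcons inE orbC => ->.
have [side sideP] := bipartite_side bip.
have suv : sd u <> sd v.
  have forced := side_forced C (fun x y xy => sideP x y (sub _ xy)).
  move=> e; have := sideP u v; rewrite mem_rcons mem_head => /(_ isT); apply.
  by rewrite (forced u) // (forced v) // ruv e.
split; try by case: C.
- by move=> x y; rewrite mem_rcons inE => /orP[/eqP[-> ->]|/(edge_rep C)].
- by move=> x y; rewrite mem_rcons inE => /orP[/eqP[-> ->]|/(edge_side C)].
- by move=> sd' sdP x xn; apply: (side_forced C) => // y z /sub; apply: sdP.
Qed.

(** [w] flips the tree of [b] exactly when the new edge would otherwise join equal sides; the
    disjunction covers both directions of union by rank. *)
Lemma unite_consistent a b (w := ~~ (sd u (+) sd v)) :
  a <> b -> rank n m b <= rank n m a ->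
  (rep u = a /\ rep v = b) \/ (rep u = b /\ rep v = a) ->
  (forall x, x < n -> m' x = m x) ->
  (forall x, x < n -> rank n m' x =
     rank n m x + ((x == a) && (rank n m a == rank n m b))) ->
  consistent m' (unite_rep rep a b) (unite_side rep sd b w) (rcons E (u, v)).
Proof.
move=> ab rab uvab mE rankE.
have [an bn] : a < n /\ b < n.
  by case: uvab => [] [<- <-]; split; apply: rep_lt F _ _.
have anb : a == b = false by apply/eqP.
have bna : b == a = false by rewrite eq_sym.
have sub e : e \in E -> e \in rcons E (u, v).
  by rewrite mem_rcons inE orbC => ->.
(* Either the tree of [x] keeps its top level, or [x] lies strictly below the new one and
   [color_top] is vacuous for it. *)
have top x : x < n -> rank n m' (unite_rep rep a b x) = rank n m (rep x) \/
    m x %/ 2 < rank n m' (unite_rep rep a b x).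
  move=> xn; have lev := color_level C xn.
  rewrite /unite_rep; case: (rep x =P b) => [e|ne].
    right; rewrite rankE // eqxx /=; rewrite e in lev; move: lev rab; case: eqP; lia.
  rewrite rankE ?(rep_lt F) //; case: eqP => [e|_] /=; last by left; rewrite addn0.
  by rewrite e in lev *; case: eqP => _; [right | left]; lia.
split.
- move=> x y; rewrite mem_rcons inE => /orP[/eqP[-> ->]|/(edge_rep C) e].
    by rewrite /unite_rep; case: uvab => [] [-> ->]; rewrite eqxx anb.
  by rewrite /unite_rep e.
- move=> x y; rewrite mem_rcons inE => /orP[/eqP[-> ->]|xy].
    rewrite /unite_side /w; case: uvab => [] [-> ->]; rewrite eqxx anb.
      by case: (sd u); case: (sd v).
    by case: (sd u); case: (sd v).
  rewrite /unite_side (edge_rep C xy); move: (edge_side C xy).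
  by case: (sd x); case: (sd y); case: (_ && _).
- by move=> x xn; rewrite mE // (color_gt0 C).
- move=> x xn; rewrite mE //; case: (top x xn) => [->|/ltnW //].
  exact: color_level C _ xn.
- move=> x xn; rewrite mE // /unite_side; have t := top x xn.
  have := rankE (rep x) (rep_lt F xn); move: t; rewrite /unite_rep.
  have lev := color_level C xn.
  case: (rep x =P b) => [e|ne] /=.
    move=> _ _ _; rewrite rankE // eqxx; rewrite e in lev; move: lev rab; case: eqP; lia.
  rewrite addbF => -[->|]; last by lia.
  by move=> _; apply: color_top C _ xn.
- move=> side sideP x xn.
  have forced := side_forced C (fun y z yz => sideP y z (sub _ yz)).
  have sab : side b = side a (+) w.
    have := sideP u v; rewrite mem_rcons mem_head => /(_ isT).
    rewrite (forced u) // (forced v) // /w; case: uvab => [] [-> ->];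
    by case: (sd u); case: (sd v); case: (side a); case: (side b).
  rewrite (forced x xn) /unite_rep /unite_side; case: eqP => [->|_] /=.
    by rewrite sab -addbA [w (+) _]addbC.
  by rewrite addbF.
Qed.

(* [u] moves to the top level of its tree, which tells it apart from all its
   neighbors at once. *)
Lemma recolor_consistent : (u, v) \in E ->
  (forall x, x < n -> m' x = if x == u then 2 * rank n m (rep u) + sd u else m x) ->
  (forall x, x < n -> rank n m' x = rank n m x) ->
  consistent m' rep sd E /\
  (forall x y : 'I_n, (x, y) \in E -> ((x, y) = (u, v) \/ m x <> m y) -> m' x <> m' y).
Proof.
move=> uvE mE rkE.
(* At rank 0 all vertices of the tree would be roots, so [u] and [v] would coincide. *)
have pos : 0 < rank n m (rep u).
  have suv := edge_side C uvE; have ruv := edge_rep C uvE.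
  rewrite lt0n; apply/eqP => r0.
  have root x : x < n -> rep x = rep u -> rep x = x.
    move=> xn e; apply: (rep_root F xn); apply/eqP/negPn/negP => lx.
    have := rank_parent F xn lx; have := rank_rep F (parent_lt F xn).
    by rewrite (rep_parent F xn) e r0; lia.
  by apply: suv; rewrite -(root u) // ruv -{2}(root v (ltn_ord v) (esym ruv)).
have rr x : x < n -> rank n m' (rep x) = rank n m (rep x).
  by move=> xn; rewrite rkE // (rep_lt F).
have half : (2 * rank n m (rep u) + sd u) %/ 2 = rank n m (rep u).
  by case: (sd u); lia.
have oddu : odd (2 * rank n m (rep u) + sd u) = sd u.
  by rewrite oddD oddM /= oddb.
split; first split; try by case: C.
- by move=> x xn; rewrite mE //; case: eqP => _; [lia | apply: color_gt0 C _ xn].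
- move=> x xn; rewrite mE // rr //; case: eqP => [->|_]; first by rewrite half.
  exact: color_level C _ xn.
- move=> x xn; rewrite mE // rr //; case: eqP => [->|_]; first by rewrite oddu.
  exact: color_top C _ xn.
(* A top-level color reveals the side, so no vertex of the other side has the new color of [u]. *)
have key (y : 'I_n) : rep y = rep u -> sd y <> sd u ->
    m y <> 2 * rank n m (rep u) + sd u.
  move=> ry sy e; apply: sy; have := color_top C (ltn_ord y).
  by rewrite ry e half oddu => ->.
move=> x y xy; rewrite !mE //.
have sxy := edge_side C xy; have rxy := edge_rep C xy.
case: (val x =P u) => [ex|nx]; case: (val y =P u) => [ey|ny].
- by case: sxy; rewrite [x : nat]ex [y : nat]ey.
- by move=> _ /esym; apply: key; rewrite -?ex // => e; apply: sxy.
- by move=> _; apply: key; rewrite -?ey.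
- by case=> // -[e _]; case: nx; rewrite e.
Qed.

End Coloring.

(** * Word RAM execution *)

(** Total correctness, with the running time passed to the postcondition; through [exec_det] it
    governs every execution. *)
Definition wp W c s (Q : nat -> state -> Prop) :=
  exists t s', exec W c s t s' /\ Q t s'.

Section WP.
Variable W : nat.

Lemma wp_skip s (Q : _ -> _ -> Prop) : Q 1 s -> wp W Skip s Q.
Proof. by move=> H; exists 1, s; split=> //; apply: exec_skip. Qed.

Lemma wp_move s i a (Q : _ -> _ -> Prop) : val_of s a < W ->
  Q 1 (set_reg s i (val_of s a)) -> wp W (Move i a) s Q.
Proof. by move=> lt H; do 2!eexists; split; [apply: exec_move | exact: H]. Qed.

Lemma wp_arith s i o a b (Q : _ -> _ -> Prop) :
  binop_val o (val_of s a) (val_of s b) < W ->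
  Q 1 (set_reg s i (binop_val o (val_of s a) (val_of s b))) ->
  wp W (Arith i o a b) s Q.
Proof. by move=> lt H; do 2!eexists; split; [apply: exec_arith | exact: H]. Qed.

Lemma wp_read s i a (Q : _ -> _ -> Prop) : val_of s a < W ->
  Q 1 (set_reg s i (Defs.mem s (val_of s a))) -> wp W (Read i a) s Q.
Proof. by move=> lt H; do 2!eexists; split; [apply: exec_read | exact: H]. Qed.

Lemma wp_write s a b (Q : _ -> _ -> Prop) : val_of s a < W -> val_of s b < W ->
  Q 1 (set_mem s (val_of s a) (val_of s b)) -> wp W (Write a b) s Q.
Proof. by move=> la lb H; do 2!eexists; split; [apply: exec_write | exact: H]. Qed.

Lemma wp_seq s c1 c2 (Q : _ -> _ -> Prop) :
  wp W c1 s (fun t1 s1 => wp W c2 s1 (fun t2 => Q (t1 + t2))) ->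
  wp W (Seq c1 c2) s Q.
Proof.
move=> [t1 [s1 [e1 [t2 [s2 [e2 H]]]]]]; exists (t1 + t2), s2; split=> //.
exact: exec_seq e1 e2.
Qed.

Lemma wp_if s b x y c1 c2 (Q : _ -> _ -> Prop) :
  (test_val b (val_of s x) (val_of s y) -> wp W c1 s (fun t => Q t.+1)) ->
  (~~ test_val b (val_of s x) (val_of s y) -> wp W c2 s (fun t => Q t.+1)) ->
  wp W (If b x y c1 c2) s Q.
Proof.
case: (boolP (test_val _ _ _)) => [bT /(_ isT) + _|bF _ /(_ isT)].
  by move=> [t [s' [e H]]]; exists t.+1, s'; split=> //; apply: exec_if_true.
by move=> [t [s' [e H]]]; exists t.+1, s'; split=> //; apply: exec_if_false.
Qed.

Lemma wp_while_true s b x y c (Q : _ -> _ -> Prop) :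
  test_val b (val_of s x) (val_of s y) ->
  wp W c s (fun t1 s1 => wp W (While b x y c) s1 (fun t2 => Q (t1 + t2).+1)) ->
  wp W (While b x y c) s Q.
Proof.
move=> bT [t1 [s1 [e1 [t2 [s2 [e2 H]]]]]]; exists (t1 + t2).+1, s2; split=> //.
exact: exec_while_true bT e1 e2.
Qed.

Lemma wp_while_false s b x y c (Q : _ -> _ -> Prop) :
  ~~ test_val b (val_of s x) (val_of s y) -> Q 1 s -> wp W (While b x y c) s Q.
Proof. by move=> bF H; exists 1, s; split=> //; apply: exec_while_false. Qed.

Lemma wp_weaken s c (P Q : nat -> state -> Prop) :
  wp W c s P -> (forall t s', P t s' -> Q t s') -> wp W c s Q.
Proof. by move=> [t [s' [e H]]] PQ; exists t, s'; split=> //; apply: PQ. Qed.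

End WP.

(** * Programs *)

Local Notation "c1 ;; c2" := (Seq c1 c2) (at level 90, right associativity).

(* [find_root] takes a vertex in register 10 and leaves its root in register 11
   and its side relative to that root in register 12; [n] is in register 2. *)
Definition walk : cmd :=
  While Lt (Imm 0) (Reg 14) (
    Arith 12 Add (Reg 12) (Reg 14) ;;
    Arith 12 Mod (Reg 12) (Imm 2) ;;
    Arith 11 Div (Reg 14) (Imm 2) ;;
    Arith 11 Defs.Sub (Reg 11) (Imm 1) ;;
    Arith 13 Add (Reg 2) (Reg 11) ;;
    Read 14 (Reg 13)).

Definition compress : cmd :=
  While Lt (Imm 0) (Reg 14) (
    Arith 18 Add (Reg 17) (Reg 16) ;;
    Write (Reg 13) (Reg 18) ;;
    Arith 16 Add (Reg 16) (Reg 14) ;;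
    Arith 16 Mod (Reg 16) (Imm 2) ;;
    Arith 15 Div (Reg 14) (Imm 2) ;;
    Arith 15 Defs.Sub (Reg 15) (Imm 1) ;;
    Arith 13 Add (Reg 2) (Reg 15) ;;
    Read 14 (Reg 13)).

Definition find_root : cmd :=
  Move 11 (Reg 10) ;;
  Move 12 (Imm 0) ;;
  Arith 13 Add (Reg 2) (Reg 11) ;;
  Read 14 (Reg 13) ;;
  walk ;;
  Move 15 (Reg 10) ;;
  Move 16 (Reg 12) ;;
  Arith 17 Add (Reg 11) (Imm 1) ;;
  Arith 17 Mul (Reg 17) (Imm 2) ;;
  Arith 13 Add (Reg 2) (Reg 15) ;;
  Read 14 (Reg 13) ;;
  compress.

#[local] Arguments upd f i x j /.

Ltac step := lazymatch goal with
  | |- wp _ (Seq _ _) _ _ => apply: wp_seq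
  | |- wp _ Skip _ _ => apply: wp_skip
  | |- wp _ (Move _ _) _ _ => apply: wp_move => /=
  | |- wp _ (Arith _ _ _ _) _ _ => apply: wp_arith => /=
  | |- wp _ (Read _ _) _ _ => apply: wp_read => /=
  | |- wp _ (Write _ _) _ _ => apply: wp_write => /=
  end.

(** * Correctness and amortized cost of [find_root] *)

Section FindRoot.
Variables (n W : nat) (rep : nat -> nat) (sd : nat -> bool).
Hypotheses (n_gt0 : 0 < n) (nW : 8 * n <= W).

Lemma odd_addb (p q : bool) c : p = q (+) odd c -> (q + c) %% 2 = p.
Proof. by move=> ->; rewrite modn2 oddD oddb. Qed.

Lemma walk_spec d s x (q : bool) : forest n (Defs.mem s) rep sd ->
  reg s 2 = n -> x < n -> reg s 11 = x -> reg s 14 = link n (Defs.mem s) x ->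
  reg s 12 = q -> depth n (Defs.mem s) d x ->
  wp W walk s (fun t s' => [/\ t <= 7 * d + 1, Defs.mem s' = Defs.mem s,
    reg s' 11 = rep x, reg s' 12 = q (+) sd x :> nat
    & forall i, i < 11 -> reg s' i = reg s i]).
Proof.
move=> F; elim: d s x q F => [|d IH] s x q F r2 xn r11 r14 r12 /=.
  move=> lx; apply: wp_while_false; first by rewrite /= r14 lx.
  have rx := rep_root F xn lx; split=> //; first by rewrite rx.
  by rewrite -[x in sd x]rx (side_rep F xn) addbF.
move=> [lx dx]; have := link_ub F xn; have := parent_lt F xn => pn lub.
have pE := parent_linked lx.
apply: wp_while_true; first by rewrite /= r14; apply/ltP; lia.
do 5![step; step; rewrite ?r12 ?r14 ?r2; first lia].
step; rewrite ?r12 ?r14 ?r2; first lia.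
rewrite subn1 -pE (@odd_addb (q (+) odd (link n (Defs.mem s) x))) //.
set s1 := set_reg _ 14 _; apply: wp_weaken (IH s1 _ _ F _ pn _ _ _ dx) _ => //.
move=> t s' [le_t -> -> -> frame]; split=> //.
- by lia.
- exact: (rep_parent F xn).
- by rewrite (side_parent F xn) -addbA [odd _ (+) _]addbC.
- by move=> i lt_i; rewrite frame // /s1 /=; do !(case: eqP => [?|_]; first lia).
Qed.

Variable L : nat.
Hypothesis nL : n <= ack L 0.

(** Register 16 carries the side of the current node and 17 the new link without its bit. The [d]
    visits are paid by the drop of potential and the credit of the first node. *)
Lemma compress_spec d s x : forest n (Defs.mem s) rep sd ->
  reg s 2 = n -> x < n -> reg s 13 = n + x -> reg s 14 = link n (Defs.mem s) x ->
  reg s 16 = sd x -> reg s 17 = 2 * (rep x).+1 -> depth n (Defs.mem s) d x ->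
  wp W compress s (fun t s' => [/\ t <= 9 * d + 1, forest n (Defs.mem s') rep sd,
    d + potential L n (Defs.mem s') <= potential L n (Defs.mem s) +
      reached_levels L (rank n (Defs.mem s) (rep x)) (rank n (Defs.mem s) x),
    forall i, i < 13 -> reg s' i = reg s i
    & forall y, y < n \/ n + n <= y -> Defs.mem s' y = Defs.mem s y]).
Proof.
move=> F; elim: d s x F => [|d IH] s x F r2 xn r13 r14 r16 r17 /=.
  move=> lx; apply: wp_while_false; first by rewrite /= r14 lx.
  by split=> //; rewrite add0n leq_addr.
move=> [lx dx]; have lub := link_ub F xn; have pn := parent_lt F xn.
have pE := parent_linked lx; have rn := rep_lt F xn.
have bs : sd x <= 1 by case: (sd x).
apply: wp_while_true; first by rewrite /= r14; apply/ltP; lia.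
step; step; rewrite ?r16 ?r17; first lia.
step; step; rewrite ?r13 ?r14 ?r16 ?r17 ?r2; first lia; first lia.
do 5![step; step; rewrite ?r14 ?r13 ?r2 ?r16; first lia].
step; rewrite ?r2 ?r14; first lia.
(* Modulo 2, adding the bit of the link removes it from the side of [x]. *)
rewrite subn1 -pE (@odd_addb (sd (parent n (Defs.mem s) x))); last first.
  by rewrite (side_parent F xn) addbK.
set m1 := upd (Defs.mem s) (n + x) (2 * (rep x).+1 + sd x).
have F1 : forest n m1 rep sd := relink_forest F xn lx.
have lt_rank : rank n (Defs.mem s) x < rank n (Defs.mem s) (parent n (Defs.mem s) x).
  by apply: (rank_parent F xn); apply/eqP.
have d1 := relink_depth F xn lx pn lt_rank dx.
have pot := relink_potential F xn lx nL.
set s1 := set_reg _ 14 _; apply: wp_weaken (IH s1 _ F1 _ pn _ _ _ _ d1) _ => //.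
  by rewrite /s1 /= r17 (rep_parent F xn).
move=> t s' [le_t F' pot' frame frame_mem]; split=> //.
- by lia.
- move: pot'; rewrite [Defs.mem s1]/= -/m1 (rep_parent F xn) !rank_relink //.
  by move: pot; rewrite /= -/m1; lia.
- by move=> i lt_i; rewrite frame // /s1 /=; do !(case: eqP => [?|_]; first lia).
- by move=> y out; rewrite frame_mem // /s1 /=; case: eqP; lia.
Qed.

(** Each link costs 7 units in [walk] and 9 in [compress], whence the factor 16; 12 covers the other
    instructions and the two final guards. *)
Lemma find_root_spec s x : forest n (Defs.mem s) rep sd ->
  reg s 2 = n -> reg s 10 = x -> x < n ->
  wp W find_root s (fun t s' => [/\ forest n (Defs.mem s') rep sd,
    t + 16 * potential L n (Defs.mem s') <= 16 * potential L n (Defs.mem s) + 16 * L + 12,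
    forall i, i < 11 -> reg s' i = reg s i,
    reg s' 11 = rep x /\ reg s' 12 = sd x
    & forall y, y < n \/ n + n <= y -> Defs.mem s' y = Defs.mem s y]).
Proof.
move=> F r2 r10 xn; have [d dx] := depth_exists F xn; have rn := rep_lt F xn.
have bs : sd x <= 1 by case: (sd x).
rewrite /find_root; do 4![step; step; rewrite ?r10 ?r2; first lia].
step; set s1 := set_reg _ 14 _.
apply: wp_weaken (@walk_spec d s1 x false F r2 xn _ _ _ dx) _ => //.
move=> t1 s2 [le_t1 mem2 w11 w12 frame2].
have {}r10 : reg s2 10 = x by rewrite frame2 // /s1 /= r10.
have {}r2 : reg s2 2 = n by rewrite frame2.
do 6![step; step; rewrite ?r10 ?r2 ?w11 ?w12 ?mem2; first lia].
set s3 := set_reg _ 14 _.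
have F3 : forest n (Defs.mem s3) rep sd by rewrite /= mem2.
apply: wp_weaken (@compress_spec d s3 x F3 _ xn _ _ _ _ _) _ => //.
- by rewrite /= mem2.
- by rewrite /= mulnC addn1.
- by rewrite /= mem2.
move=> t3 s4 [le_t3 F4 pot frame frame_mem]; split=> //.
- have := reached_levels_ub L (rank n (Defs.mem s3) (rep x)) (rank n (Defs.mem s3) x).
  by move: pot; rewrite /= mem2 /s1 /=; lia.
- move=> i lt_i; rewrite frame ?(ltn_trans lt_i) // /s3 /=.
  do !(case: eqP => [?|_]; first lia); rewrite frame2 // /s1 /=.
  by do !(case: eqP => [?|_]; first lia).
- by rewrite !frame.
- by move=> y out; rewrite frame_mem // /s3 /= mem2.
Qed.

End FindRoot.

Section Frame.
Variables (n : nat) (m m' : nat -> nat) (rep : nat -> nat) (sd : nat -> bool).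
Variable E : seq ('I_n * 'I_n).

Lemma consistent_frame : (forall y, y < n \/ n + n <= y -> m' y = m y) ->
  consistent m rep sd E -> consistent m' rep sd E.
Proof.
move=> mE [? ? pos lev top ?].
have colE x : x < n -> m' x = m x by move=> xn; apply: mE; left.
have rkE x : rank n m' x = rank n m x by apply: mE; right; apply: leq_addr.
by split=> // x xn; rewrite ?colE ?rkE //; auto.
Qed.

Lemma properly_colored_frame : (forall y, y < n -> m' y = m y) ->
  properly_colored m E -> properly_colored m' E.
Proof. by move=> mE P u v uv; rewrite !mE //; apply: P. Qed.

Hypothesis mE : forall y, n <= y -> m' y = m y.

Lemma link_frame x : link n m' x = link n m x.
Proof. exact/mE/leq_addr. Qed.

Lemma rank_frame x : rank n m' x = rank n m x.
Proof. by apply: mE; rewrite -addnA leq_addr. Qed.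

Lemma parent_frame x : parent n m' x = parent n m x.
Proof. by rewrite /parent link_frame. Qed.

Lemma forest_frame : forest n m rep sd -> forest n m' rep sd.
Proof.
move=> F; split=> x xn; rewrite ?link_frame ?rank_frame ?parent_frame;
  by case: F => *; auto.
Qed.

Lemma potential_frame L : potential L n m' = potential L n m.
Proof.
by apply: eq_bigr => x _; rewrite link_frame !rank_frame parent_frame.
Qed.

End Frame.

Definition unite : cmd :=
  If Eq (Reg 3) (Reg 11) Skip
   (If Lt (Reg 7) (Reg 9)
     (Arith 14 Add (Reg 11) (Imm 1) ;;
      Arith 14 Mul (Reg 14) (Imm 2) ;;
      Arith 14 Add (Reg 14) (Reg 13) ;;
      Arith 15 Add (Reg 2) (Reg 3) ;;
      Write (Reg 15) (Reg 14) ;;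
      Move 7 (Reg 9) ;;
      Arith 4 Add (Reg 4) (Reg 13) ;;
      Arith 4 Mod (Reg 4) (Imm 2))
     (Arith 14 Add (Reg 3) (Imm 1) ;;
      Arith 14 Mul (Reg 14) (Imm 2) ;;
      Arith 14 Add (Reg 14) (Reg 13) ;;
      Arith 15 Add (Reg 2) (Reg 11) ;;
      Write (Reg 15) (Reg 14) ;;
      If Eq (Reg 7) (Reg 9)
       (Arith 7 Add (Reg 7) (Imm 1) ;;
        Write (Reg 6) (Reg 7))
       Skip)).

Definition recolor : cmd :=
  Read 5 (Reg 0) ;;
  Read 6 (Reg 1) ;;
  If Eq (Reg 5) (Reg 6)
   (Arith 7 Mul (Reg 7) (Imm 2) ;;
    Arith 7 Add (Reg 7) (Reg 4) ;;
    Write (Reg 0) (Reg 7))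
   Skip.

(* Before [unite], registers 3 and 11 hold the roots of the endpoints, 4 and 12
   their sides, 7 and 9 the ranks of the roots, and 13 the side of one root
   relative to the other.  After it, 7 holds the rank of the common root and 4
   the side of the first endpoint. *)
Definition insert_edge : cmd :=
  Move 10 (Reg 0) ;;
  find_root ;;
  Move 3 (Reg 11) ;;
  Move 4 (Reg 12) ;;
  Move 10 (Reg 1) ;;
  find_root ;;
  Arith 5 Add (Reg 2) (Reg 2) ;;
  Arith 6 Add (Reg 5) (Reg 3) ;;
  Read 7 (Reg 6) ;;
  Arith 8 Add (Reg 5) (Reg 11) ;;
  Read 9 (Reg 8) ;;
  Arith 13 Add (Reg 4) (Reg 12) ;;
  Arith 13 Add (Reg 13) (Imm 1) ;;
  Arith 13 Mod (Reg 13) (Imm 2) ;;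
  unite ;;
  recolor.

Definition initialize : cmd :=
  Move 2 (Reg 0) ;;
  Move 3 (Imm 0) ;;
  While Lt (Reg 3) (Reg 2)
   (Write (Reg 3) (Imm 1) ;;
    Arith 3 Add (Reg 3) (Imm 1)).

Definition coloring_algorithm : algorithm :=
  Algorithm initialize insert_edge (Read 0 (Reg 0)).

Definition coloring_invariant n (E : seq ('I_n * 'I_n)) s : Prop :=
  exists rep sd, [/\ forest n (Defs.mem s) rep sd, consistent (Defs.mem s) rep sd E,
    properly_colored (Defs.mem s) E & reg s 2 = n].

(** * Correctness and amortized cost of an insertion *)

Section Insert.
Variables (n W L : nat) (E : seq ('I_n * 'I_n)) (u v : 'I_n).
Hypotheses (n_gt0 : 0 < n) (nW : 8 * n <= W) (nL : n <= ack L 0).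
Hypothesis bip : bipartite (adj (rcons E (u, v))).

Lemma unite_spec s rep sd : forest n (Defs.mem s) rep sd ->
  consistent (Defs.mem s) rep sd E -> reg s 2 = n ->
  reg s 3 = rep u -> reg s 4 = sd u -> reg s 6 = n + n + rep u ->
  reg s 7 = rank n (Defs.mem s) (rep u) -> reg s 9 = rank n (Defs.mem s) (rep v) ->
  reg s 11 = rep v -> reg s 13 = ~~ (sd u (+) sd v) ->
  wp W unite s (fun t s' => exists rep' sd',
   [/\ forest n (Defs.mem s') rep' sd',
       consistent (Defs.mem s') rep' sd' (rcons E (u, v)),
       t <= 11 /\ potential L n (Defs.mem s') <= potential L n (Defs.mem s) + 3 * L,
       [/\ forall i, i < 3 -> reg s' i = reg s i,
           reg s' 7 = rank n (Defs.mem s') (rep' u) & reg s' 4 = sd' u]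
     & forall x, x < n -> Defs.mem s' x = Defs.mem s x]).
Proof.
move=> F C r2 r3 r4 r6 r7 r9 r11 r13.
have run := rep_lt F (ltn_ord u); have rvn := rep_lt F (ltn_ord v).
have lu := link_rep F (ltn_ord u); have lv := link_rep F (ltn_ord v).
have rku := rank_lt F run; have rkv := rank_lt F rvn.
set w := ~~ _ in r13; have w1 : w <= 1 by case: (w).
have su1 : sd u <= 1 by case: (sd u).
apply: wp_if => /=; rewrite r3 r11 => /eqP ruv.
  apply: wp_skip; exists rep, sd; split=> //; first exact: consistent_rcons.
  by split=> //; apply: leq_addr.
apply: wp_if => /=; rewrite r7 r9 => lt_rk.
  do 7![step; step; rewrite ?r2 ?r3 ?r4 ?r9 ?r11 ?r13; try lia].
  step; rewrite ?r2 ?r3 ?r4 ?r9 ?r11 ?r13; first lia.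
  (* Here the tree of [u] is the one attached, so the side in register 4 is flipped by [w]. *)
  rewrite (@odd_addb (sd u (+) w)) ?oddb //.
  set m1 := upd _ _ _.
  have le_rk := ltnW lt_rk.
  have linkE x : x < n -> link n m1 x =
      if x == rep u then 2 * (rep v).+1 + w else link n (Defs.mem s) x.
    by move=> xn; rewrite /link /m1 /= eqn_add2l mulnC addn1.
  have rankE x : x < n -> rank n m1 x = rank n (Defs.mem s) x +
     ((x == rep v) && (rank n (Defs.mem s) (rep v) == rank n (Defs.mem s) (rep u))).
    move=> xn; have -> : rank n (Defs.mem s) (rep v) == rank n (Defs.mem s) (rep u) = false.
      by apply/eqP; move/ltP: lt_rk; lia.
    by rewrite andbF addn0 /rank /m1 /=; case: eqP => //; lia.
  have colE x : x < n -> m1 x = Defs.mem s x.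
    by move=> xn; rewrite /m1 /=; case: eqP => //; lia.
  exists (unite_rep rep (rep v) (rep u)), (unite_side rep sd (rep u) w); split=> //.
  - exact: (unite_forest F rvn run lv lu (nesym ruv) le_rk linkE rankE).
  - by apply: (unite_consistent F C) => //; [apply: nesym | right].
  - by split=> //; apply: (unite_potential (w := w) F rvn run) => //; apply: nesym.
  - split=> //; first by move=> i lt_i /=; do !(case: eqP => [?|_]; first lia).
      rewrite /unite_rep eqxx rankE // eqxx /=.
      by case: eqP => //; move/ltP: lt_rk; lia.
    by rewrite /unite_side eqxx.
rewrite -leqNgt in lt_rk.
do 5![step; step; rewrite ?r2 ?r3 ?r4 ?r9 ?r11 ?r13; try lia].
pose rep' := unite_rep rep (rep u) (rep v).
pose sd' := unite_side rep sd (rep v) w.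
have repu : rep' u = rep u by rewrite /rep' /unite_rep; case: eqP.
have sdu : sd' u = sd u by rewrite /sd' /unite_side; case: eqP => //; rewrite addbF.
have post m1 :
    (forall x, x < n -> link n m1 x =
       if x == rep v then 2 * (rep u).+1 + w else link n (Defs.mem s) x) ->
    (forall x, x < n -> rank n m1 x = rank n (Defs.mem s) x +
       ((x == rep u) && (rank n (Defs.mem s) (rep u) == rank n (Defs.mem s) (rep v)))) ->
    (forall x, x < n -> m1 x = Defs.mem s x) ->
    [/\ forest n m1 rep' sd', consistent m1 rep' sd' (rcons E (u, v))
       & potential L n m1 <= potential L n (Defs.mem s) + 3 * L].
  move=> linkE rankE colE; split.
  - exact: (unite_forest F run rvn lu lv ruv lt_rk linkE rankE).
  - by apply: (unite_consistent F C) => //; left.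
  - exact: (unite_potential F run rvn lu lv ruv lt_rk linkE rankE).
apply: wp_if => /=; rewrite ?r7 ?r9 => /eqP eq_rk.
  step; step; rewrite ?r7; first lia.
  step; rewrite ?r6; [lia | lia |].
  rewrite /=; set m1 := upd _ _ _.
  have rankE x : x < n -> rank n m1 x = rank n (Defs.mem s) x +
     ((x == rep u) && (rank n (Defs.mem s) (rep u) == rank n (Defs.mem s) (rep v))).
    move=> xn; rewrite eq_rk eqxx andbT /rank /m1 /= eqn_add2l.
    case: (x =P rep u) => [->|_]; first by [].
    by rewrite addn0 ifF //; apply/eqP; lia.
  have [||F1 C1 pot1] := post m1 _ rankE.
  - move=> x xn; rewrite /link /m1 /= ifF; last by apply/eqP; lia.
    by rewrite eqn_add2l mulnC addn1.
  - by move=> x xn; rewrite /m1 /=; do !(case: eqP => [?|_]; first lia).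
  exists rep', sd'; split=> //.
    split=> //; first by move=> i lt_i; do !(case: eqP => [?|_]; first lia).
      by rewrite repu rankE // eqxx eq_rk eqxx.
    by rewrite sdu.
  by move=> x xn; do !(case: eqP => [?|_]; first lia).
step; rewrite /=; set m1 := upd _ _ _.
have rankE x : x < n -> rank n m1 x = rank n (Defs.mem s) x +
   ((x == rep u) && (rank n (Defs.mem s) (rep u) == rank n (Defs.mem s) (rep v))).
  move=> xn; move/eqP/negPf: eq_rk => ->.
  by rewrite andbF addn0 /rank /m1 /=; case: eqP => //; lia.
have [||F1 C1 pot1] := post m1 _ rankE.
- by move=> x xn; rewrite /link /m1 /= eqn_add2l mulnC addn1.
- by move=> x xn; rewrite /m1 /=; case: eqP => //; lia.
exists rep', sd'; split=> //.
  split=> //; first by move=> i lt_i; do !(case: eqP => [?|_]; first lia).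
    by rewrite repu rankE //; move/eqP/negPf: eq_rk => ->; rewrite andbF addn0.
  by rewrite sdu.
by move=> x xn; case: eqP => //; lia.
Qed.

Lemma recolor_spec s rep sd : forest n (Defs.mem s) rep sd ->
  consistent (Defs.mem s) rep sd (rcons E (u, v)) ->
  properly_colored (Defs.mem s) E -> reg s 0 = u -> reg s 1 = v ->
  reg s 7 = rank n (Defs.mem s) (rep u) -> reg s 4 = sd u ->
  wp W recolor s (fun t s' =>
   [/\ forest n (Defs.mem s') rep sd,
       consistent (Defs.mem s') rep sd (rcons E (u, v)),
       properly_colored (Defs.mem s') (rcons E (u, v)),
       t <= 6 /\ reg s' 2 = reg s 2
     & forall x : nat, x != u -> Defs.mem s' x = Defs.mem s x]).
Proof.
move=> F C P r0 r1 r7 r4.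
have un := ltn_ord u; have vn := ltn_ord v.
have rk := rank_lt F (rep_lt F un); have su1 : sd u <= 1 by case: (sd u).
have uvE : (u, v) \in rcons E (u, v) by rewrite mem_rcons mem_head.
rewrite /recolor; do 2![step; step; rewrite ?r0 ?r1; first lia].
apply: wp_if => /= /eqP col.
  do 2![step; step; rewrite ?r0 ?r1 ?r4 ?r7; first lia].
  step; rewrite ?r0 ?r1 ?r4 ?r7; [lia | lia |].
  rewrite /= mulnC; set m1 := upd _ _ _.
  have mE y : n <= y -> m1 y = Defs.mem s y.
    by move=> ny; rewrite /m1 /=; case: eqP => //; lia.
  have [||C1 P1] := recolor_consistent (m' := m1) F C uvE; [by []| |].
    by move=> x _; apply: rank_frame.
  split=> //; first exact: forest_frame F.
    move=> x y xy; apply: (P1 _ _ xy).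
    by move: xy; rewrite mem_rcons inE => /orP[/eqP|/P]; [left | right].
  by move=> x /negPf ne; rewrite /m1 /= ne.
step; split=> //.
by move=> x y; rewrite mem_rcons inE => /orP[/eqP[-> ->]|/P].
Qed.

(** Two searches cost [32 * L + 24], the link raises the potential by at most [3 * L] with weight
    16, and 60 leaves room for the rest. Only [recolor] writes a color, and only that of [u]. *)
Lemma insert_edge_spec s : coloring_invariant E s ->
  wp W insert_edge (insert_call s u v) (fun t s' =>
   [/\ coloring_invariant (rcons E (u, v)) s',
       t + 16 * potential L n (Defs.mem s')
         <= 16 * potential L n (Defs.mem s) + 80 * L + 60
     & forall x, x < n -> x != u -> Defs.mem s' x = Defs.mem s x]).
Proof.
move=> [rep [sd [F C P r2]]]; have un := ltn_ord u; have vn := ltn_ord v.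
have run := rep_lt F un; have rvn := rep_lt F vn.
have su1 : sd u <= 1 by case: (sd u).
have sv1 : sd v <= 1 by case: (sd v).
rewrite /insert_edge; step; step; first lia.
set s0 := set_reg _ 10 _.
step; apply: wp_weaken (@find_root_spec _ _ _ _ n_gt0 nW _ nL s0 u F r2 _ un) _ => //.
move=> t1 s1 [F1 pot1 frame1 [s1_11 s1_12] mem1].
do 3![step; step; rewrite ?s1_11 ?s1_12 ?(frame1 1) //=; first lia].
set s2 := set_reg _ 10 _.
have s2_2 : reg s2 2 = n by rewrite /= frame1.
step; apply: wp_weaken (@find_root_spec _ _ _ _ n_gt0 nW _ nL s2 v F1 s2_2 _ vn) _ => //.
move=> t2 s3 [F3 pot3 frame3 [s3_11 s3_12] mem3].
have s3_0 : reg s3 0 = u by rewrite frame3 //= frame1.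
have s3_1 : reg s3 1 = v by rewrite frame3 //= frame1.
have {}s2_2 : reg s3 2 = n by rewrite frame3.
have s3_3 : reg s3 3 = rep u by rewrite frame3.
have s3_4 : reg s3 4 = sd u by rewrite frame3.
have mem03 y : y < n \/ n + n <= y -> Defs.mem s3 y = Defs.mem s y.
  by move=> out; rewrite mem3 //= mem1.
have C3 := consistent_frame mem03 C.
have P3 : properly_colored (Defs.mem s3) E.
  by apply: properly_colored_frame P => y yn; apply: mem03; left.
do 8![step; step; rewrite ?s2_2 ?s3_3 ?s3_4 ?s3_11 ?s3_12; first lia].
set s4 := set_reg _ 13 _.
have s4_13 : reg s4 13 = ~~ (sd u (+) sd v).
  by rewrite /= modn2 !oddD !oddb addbT.
step; apply: wp_weaken (@unite_spec s4 rep sd F3 C3 _ _ _ _ _ _ _ s4_13) _ => //.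
move=> t5 s5 [rep5 [sd5 [F5 C5 [t5_le pot5] [frame5 s5_7 s5_4] mem5]]].
have P5 : properly_colored (Defs.mem s5) E by apply: properly_colored_frame P3.
apply: wp_weaken (recolor_spec F5 C5 P5 _ _ s5_7 s5_4) _; rewrite ?frame5 //.
move=> t6 s6 [F6 C6 P6 [t6_le s6_2] mem6]; split.
- by exists rep5, sd5; split=> //; rewrite s6_2.
- rewrite (@potential_frame n (Defs.mem s5)); last first.
    by move=> y ny; apply: mem6; apply/eqP; lia.
  by rewrite /= in pot1 pot3 pot5; lia.
- by move=> x xn xu; rewrite mem6 // mem5 // mem03 //; left.
Qed.

End Insert.

(** The bound is the fourth power of a power of two exceeding [n]: one factor dominates [n], the
    other three together give 8. *)
Lemma word_bound_ge n : 0 < n -> 8 * n <= word_bound 4 n.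
Proof.
move=> n_gt0; rewrite /word_bound [4 * _]mulnC expnM.
have := @trunc_log_ltn 2 n isT; rewrite expnS; set X := 2 ^ _ => ltX.
have X_gt0 : 0 < X by rewrite expn_gt0.
have : 8 <= (2 * X) ^ 3 by rewrite -[8]/(2 ^ 3) leq_exp2r // leq_pmulr.
by rewrite [_ ^ 4]expnSr => le8; apply: leq_mul => //; apply: ltnW.
Qed.

Lemma log2_ge r n : 2 ^ r <= n -> Rle (INR r) (log2 (INR n)).
Proof.
move=> /leP/le_INR; have -> : INR (2 ^ r) = pow 2 r.
  by elim: r => [|r IH] //=; rewrite expnS -multE mult_INR IH.
move=> le_n; have pos : Rlt 0 (pow 2 r) by apply: pow_lt; lra.
have ln2 : Rlt 0 (ln 2) by rewrite -ln_1; apply: ln_increasing; lra.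
rewrite /log2; apply: (Rmult_le_reg_r (ln 2)) => //.
rewrite /Rdiv Rmult_assoc Rinv_l ?Rmult_1_r -?ln_pow; try lra.
case: le_n => [/(ln_increasing _ _ pos)|->]; [exact: Rlt_le | exact: Rle_refl].
Qed.

Lemma edges_rcons n (ops : seq (op n)) o :
  edges (rcons ops o) = if o is Insert u v then rcons (edges ops) (u, v) else edges ops.
Proof. by rewrite /edges -cats1 pmap_cat; case: o => * /=; rewrite ?cats1 ?cats0. Qed.

Lemma query_spec n W s (v : 'I_n) : 8 * n <= W ->
  wp W (Read 0 (Reg 0)) (query_call s v) (fun t s' =>
    [/\ t = 1, reg s' 0 = Defs.mem s v, reg s' 2 = reg s 2 & Defs.mem s' = Defs.mem s]).
Proof. by move=> nW; have vn := ltn_ord v; step; first lia. Qed.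

(** * Initialization and whole runs *)

Section Run.
Variables (n W L : nat).
Hypotheses (n_gt0 : 0 < n) (nW : 8 * n <= W) (nL : n <= ack L 0).

(** Zeroed memory already encodes singleton trees of rank 0, so only the color 1 of level 0 has to
    be written. *)
Lemma initialize_spec : wp W initialize (start n) (fun t s =>
  [/\ t <= 3 * n + 3, @coloring_invariant n [::] s & potential L n (Defs.mem s) = 0]).
Proof.
have fill k s : reg s 2 = n -> reg s 3 + k = n ->
    wp W (While Lt (Reg 3) (Reg 2) (Write (Reg 3) (Imm 1) ;; Arith 3 Add (Reg 3) (Imm 1))) s
      (fun t s' => [/\ t <= 3 * k + 1, reg s' 2 = n & forall y,
        Defs.mem s' y = if reg s 3 <= y < n then 1 else Defs.mem s y]).
  elim: k s => [|k IH] s r2 r3.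
    apply: wp_while_false; first by rewrite /= r2 -leqNgt; lia.
    by split=> // y; case: ifP => //; lia.
  apply: wp_while_true; first by rewrite /= r2; apply/ltP; lia.
  step; step; [lia | lia |]; step => /=; first lia.
  set s1 := set_reg _ 3 _; apply: wp_weaken (IH s1 _ _) _ => //=; first by rewrite -r3; lia.
  move=> t s' [le_t r2' memE]; split=> //; first by lia.
  move=> y; rewrite memE.
  case: (y =P reg s 3) => [->|ne]; first by rewrite leqnn ifF ?ifT //; lia.
  by congr (if _ then _ else _); lia.
rewrite /initialize; do 2![step; step => /=; first lia].
set s0 := set_reg _ 3 _; apply: wp_weaken (fill n s0 _ _) _ => //.
move=> t s [le_t r2 memE].
have linkE x : x < n -> link n (Defs.mem s) x = 0.
  by move=> xn; rewrite /link memE /= ifF //; lia.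
have rankE x : x < n -> rank n (Defs.mem s) x = 0.
  by move=> xn; rewrite /rank memE /= ifF //; lia.
have parentE x : x < n -> parent n (Defs.mem s) x = x.
  by move=> xn; rewrite /parent linkE.
have colE x : x < n -> Defs.mem s x = 1 by move=> xn; rewrite memE /= xn.
split; first by rewrite /=; lia.
  exists id, (fun=> false); split=> //.
  - split=> // x xn; rewrite ?linkE ?rankE ?parentE //.
    by rewrite (bigD1 (Ordinal xn)) //= eqxx.
  - split=> // x xn; rewrite ?colE ?rankE //.
    by move=> y _; rewrite addbF.
by rewrite /potential big1 // => x _; rewrite linkE // rankE // muln0.
Qed.

(** The amortized costs telescope from potential 0; queries leave the memory alone. *)
Lemma run_invariant (ops : seq (op n)) s T :
  run coloring_algorithm W ops s T -> bipartite (adj (edges ops)) ->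
  coloring_invariant (edges ops) s /\
  T + 16 * potential L n (Defs.mem s) <= size (edges ops) * (80 * L + 60).
Proof.
elim=> {ops s T} [t s ex _|ops s T u v t s' _ IH ex|ops s T v t s' _ IH ex].
- have [t' [s' [ex' [_ inv pot]]]] := initialize_spec.
  by have [_ ->] := exec_det ex ex'; rewrite pot.
- rewrite edges_rcons => bip; have [inv pot] := IH (bipartite_rcons bip).
  have [t' [s'' [ex' [inv' pot' _]]]] := insert_edge_spec n_gt0 nW nL bip inv.
  have [-> ->] := exec_det ex ex'; split=> //.
  by rewrite size_rcons mulSn; lia.
- rewrite edges_rcons => /IH [[rep [sd [F C P r2]]] pot].
  have [t' [s'' [ex' [_ _ r2' memE]]]] := query_spec s v nW.
  have [_ ->] := exec_det ex ex'; rewrite memE; split=> //.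
  by exists rep, sd; split; rewrite ?memE // r2'.
Qed.

End Run.

Theorem theorem3 :
  exists (A : algorithm) (K C : nat), forall n : nat, 0 < n ->
    let W := word_bound K n in
    (exists t s, exec W (init A) (start n) t s /\ t <= C * n) /\
    forall (ops : seq (op n)) (s : state) (T : nat),
      run A W ops s T -> bipartite (adj (edges ops)) ->
      [/\ (* a proper coloring with colors in {1, ..., 1 + 2 log n} is stored *)
          (forall x : 'I_n, in_palette (1 + 2 * log2 (INR n)) (color s x)) /\
          proper_coloring (adj (edges ops)) (@color n s),
          (* amortized update time *)
          T <= C * size (edges ops) * inv_ack n,
          (* the next update terminates and makes at most one recoloring *)
          forall u v : 'I_n, bipartite (adj (rcons (edges ops) (u, v))) ->
            exists t s', exec W (insert A) (insert_call s u v) t s' /\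
                         recolorings n s s' <= 1
        & (* worst-case query time; a query does not change the coloring *)
          forall v : 'I_n, exists t s',
            [/\ exec W (query A) (query_call s v) t s', t <= C,
                reg s' 0 = color s v & forall x : 'I_n, color s' x = color s x]].
Proof.
(* With [L = inv_ack n + 2], [80 * L + 60 = 80 * inv_ack n + 220], which is at most
   [300 * inv_ack n] once [inv_ack n >= 1]. *)
exists coloring_algorithm, 4, 300 => n n_gt0 W.
have nW : 8 * n <= W := word_bound_ge n_gt0.
have nL : n <= ack (inv_ack n).+2 0 := leq_ack_inv_ack n.
split.
  have [t [s [ex [le_t _ _]]]] := initialize_spec n_gt0 nW nL.
  by exists t, s; split=> //; lia.
move=> ops s T /(run_invariant n_gt0 nW nL) inv_run /[dup] bip /inv_run [inv le_T].
have [rep [sd [F C P r2]]] := inv; split.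
- split=> [x|u v /orP[/P //|/P ne /esym //]].
  have xn := ltn_ord x; split; first exact: (color_gt0 C xn).
  have lev := color_level C xn; have /log2_ge := rank_ub F xn.
  (* From [c %/ 2 <= r] follows [c <= 2 * r + 1], and [2 ^ r <= n]. *)
  set r := rank _ _ _ in lev *; set c := color s x => le_r.
  have /leP/le_INR : c <= 2 * r + 1 by rewrite /c /color; lia.
  by rewrite -multE -plusE plus_INR mult_INR /=; lra.
- apply: leq_trans (leq_addr _ _) (leq_trans le_T _); rewrite [300 * _]mulnC -mulnA.
  (* Without edges both sides are 0. An edge has endpoints on different sides, so [n >= 2] and
     [inv_ack n >= 1]. *)
  case E0: (edges ops) => [|[u v] E] //; rewrite leq_mul2l; apply/orP; right.
  suff /inv_ack_gt0 : 1 < n by lia.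
  rewrite ltnNge; apply/negP => n1; have := @edge_side _ _ _ _ _ C u v.
  rewrite E0 mem_head => /(_ isT); apply; congr sd.
  by have := ltn_ord u; have := ltn_ord v; lia.
- move=> u v bip'.
  have [t [s' [ex [_ _ memE]]]] := insert_edge_spec n_gt0 nW nL bip' inv.
  exists t, s'; split=> //; rewrite -(cards1 u); apply: subset_leq_card.
  apply/subsetP => x; rewrite !inE; apply: contraR => xu.
  by rewrite /color memE.
- move=> v; have [t [s' [ex [t1 r0 _ memE]]]] := query_spec s v nW.
  by exists t, s'; split=> //; [rewrite t1 | move=> x; rewrite /color memE].
Qed.
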